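(* (Global smoothness indicator for the one-dimensional CWENOZ3 reconstruction.) With $I_0,I_1,I_2$ the smoothness indicators defined in the context, any set of real coefficients such that $\lambda_1=\lambda_2$ and $\lambda_0=-2\lambda_1$ cancels all terms up to order $\Delta x^3$ in $\lambda_0I_0+\lambda_1I_1+\lambda_2I_2$, but it is never possible to cancel all the terms of order $\Delta x^4$. So, defining $$\hat\tau_3=|\,t I_1+t I_2-2t I_0\,|,$$ one has, for any $t\in\mathbb{R}$, $\theta(\hat\tau_3)=4$.
   Context: Notation: $\theta(g(\rho))=r$ means that $g(\rho)=a_r\rho^r+o(\rho^r)$ for $\rho\to0$ with $a_r\neq0$; here $\rho=\Delta x$. Let $u$ be a smooth real function of one variable near $0$, let $\Omega_i=[(i-\tfrac12)\Delta x,(i+\tfrac12)\Delta x]$ and let $\overline u_i$ be the average of $u$ on $\Omega_i$. $P_1$ and $P_2$ are the polynomials of degree at most $1$ whose cell averages match $\overline u_i$ on $i\in\{-1,0\}$ and $i\in\{0,1\}$ respectively; $P_{\mathrm{opt}}$ is the polynomial of degree at most $2$ whose cell averages match $\overline u_i$ for $i\in\{-1,0,1\}$. For a polynomial $q$ of degree at most $d$, $I[q]=\sum_{\beta=1}^{d}\Delta x^{2\beta-1}\int_{\Omega_0}(q^{(\beta)}(x))^2\,dx$. Set $I_0=I[P_{\mathrm{opt}}]$, $I_1=I[P_1]$, $I_2=I[P_2]$. A global smoothness indicator is a quantity $|\lambda_0I_0+\lambda_1I_1+\lambda_2I_2|$ with real coefficients satisfying $\lambda_0+\lambda_1+\lam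bda_2=0$.
   Formalization: Order exactly 4 is stated for t≠0 and u''(0)≠0 (otherwise τ̂₃ is 0 or o(Δx⁴)); non-cancellation of Δx⁴ is stated for λ₁≠0 and u''(0)≠0 in the family, and for all nonzero λ with sum 0 when also u'(0)≠0. *)

(* Defs.v *)
From mathcomp Require Import all_boot all_order all_algebra.
From mathcomp Require Import all_classical all_reals all_analysis.

Set Implicit Arguments.
Unset Strict Implicit.
Unset Printing Implicit Defensive.

Import Order.TTheory GRing.Theory Num.Theory.
Import numFieldNormedType.Exports.

Local Open Scope classical_set_scope.
Local Open Scope ring_scope.

(* A single neighbourhood of 0 serves for all orders of differentiation. *)
Definition smooth_near0 (R : realType) (u : R -> R) : Prop :=
  \forall x \near (0 : R), forall n : nat, derivable (derive1n n u) x 1.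

Definition cell (R : realType) (h : R) (i : int) : set R :=
  `[(i%:~R - 2^-1) * h, (i%:~R + 2^-1) * h].

Definition cell_average (R : realType) (u : R -> R) (h : R) (i : int) : R :=
  (\int[lebesgue_measure]_(x in cell h i) u x) / h.

(* [size p <= d.+1] says that p has degree at most d. *)
Definition reconstructs (R : realType) (u : R -> R) (h : R)
    (d : nat) (stencil : seq int) (p : {poly R}) : Prop :=
  (size p <= d.+1)%N /\
  forall i : int, i \in stencil ->
    cell_average (fun x => p.[x]) h i = cell_average u h i.

(* The sum stops at the exact degree of q: for any larger bound on the degree,
   the additional derivatives vanish. *)
Definition smoothness_indicator (R : realType) (h : R) (q : {poly R}) : R :=
  \sum_(1 <= b < size q)
    h ^+ (2 * b - 1) *
    \int[lebesgue_measure]_(x in cell h 0) ((q^`(b)).[x] ^+ 2).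

(* The cell size is positive, so that limits are taken from the right. *)
Definition theta_eq (R : realType) (g : R -> R) (r : nat) : Prop :=
  exists2 a : R, a != 0 &
    (fun h : R => g h - a * h ^+ r) =o_ (0^'+) (fun h : R => h ^+ r).

(* For g with an asymptotic expansion in powers of h, all its terms of
   order 0, ..., n vanish. *)
Definition cancels_up_to (R : realType) (g : R -> R) (n : nat) : Prop :=
  g =o_ (0^'+) (fun h : R => h ^+ n).

(* Main.v *)
Require Import Defs.
From mathcomp Require Import all_boot all_order all_algebra.
From mathcomp Require Import all_classical all_reals all_analysis.
From mathcomp Require Import ring lra.

Set Implicit Arguments.
Unset Strict Implicit.
Unset Printing Implicit Defensive.

Import Order.TTheory GRing.Theory Num.Theory.
Import numFieldNormedType.Exports.

Local Open Scope classical_set_scope.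
Local Open Scope ring_scope.

(** Write [a], [b], [c] for the averages of [u] on the cells -1, 0, 1, and put
    [D = (c - a) / 2] and [E = c - 2 b + a]. Matching the averages gives the
    linear and quadratic coefficients of the three reconstructions in terms of
    [D], [E] and the cell size [h], and integrating the squared
    derivatives over the central cell gives exactly
      [I0 = D^2 + 13/12 E^2],  [I1 = (D - E/2)^2],  [I2 = (D + E/2)^2]
    ([smoothness_indicator_opt], [smoothness_indicator_left],
    [smoothness_indicator_right]). Hence, when [l0 + l1 + l2 = 0], the squares
    of [D] cancel and
      [l0 I0 + l1 I1 + l2 I2 = (l2 - l1) D E + 5/6 l0 E^2].

    A second-order Taylor expansion of [u] at 0, integrated over the cells,
    shows [D / h --> u'(0)] and [E / h^2 --> u''(0)]
    ([central_diff_cvg], [second_diff_cvg]). Thus [D E] is of order 3 and [E^2]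
    of order 4. If [l1 = l2], only [5/6 l0 E^2] remains, whose leading
    coefficient [5/6 l0 u''(0)^2] is nonzero unless [l0] or [u''(0)] vanishes; with
    [l0 = - 2 t] it is [- 5/3 t u''(0)^2]. If [l1 <> l2], the term
    [(l2 - l1) u'(0) u''(0) h^3] survives already at order 3 when [u'(0)] and
    [u''(0)] are both nonzero. *)

(** * Integrals of quadratics over cells *)

Lemma Rintegral_horner (R : realType) (a b : R) (p q : {poly R}) :
  a < b -> q^`() = p ->
  \int[lebesgue_measure]_(x in `[a, b]) p.[x] = q.[b] - q.[a].
Proof.
move=> ab <-; rewrite /Rintegral (@continuous_FTC2 _ _ (horner q)) //=.
- exact/continuous_subspaceT/continuous_horner.
- split; first by move=> x _; exact: derivable_horner.
  + exact/cvg_at_right_filter/continuous_horner.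
  + exact/cvg_at_left_filter/continuous_horner.
- by move=> x _; rewrite derivE.
Qed.

(** The [1/12] is the second moment of the unit interval centred at 0. *)
Lemma Rintegral_cell_quadratic (R : realType) (h : R) (i : int) (a b c : R) :
  0 < h ->
  \int[lebesgue_measure]_(x in cell h i) (a + b * x + c * x ^+ 2) =
  h * (a + b * (i%:~R * h) + c * (i%:~R ^+ 2 + 12^-1) * h ^+ 2).
Proof.
move=> h0.
pose q : {poly R} := a *: 'X + (b / 2) *: 'X^2 + (c / 3) *: 'X^3.
have qE x : q.[x] = a * x + b / 2 * x ^+ 2 + c / 3 * x ^+ 3.
  by rewrite /q !hornerE.
have dqE x : q^`().[x] = a + b * x + c * x ^+ 2.
  by rewrite /q !poly.derivE !hornerE /=; field.
have ltab : (i%:~R - 2^-1) * h < (i%:~R + 2^-1) * h by nra.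
under eq_Rintegral do rewrite -dqE.
by rewrite (Rintegral_horner ltab (erefl _)) !qE; field.
Qed.

Lemma quadratic_coef (R : realType) (p : {poly R}) : (size p <= 3)%N ->
  p = p`_0 *: 1 + p`_1 *: 'X + p`_2 *: 'X^2.
Proof.
move=> sp; apply/polyP => -[|[|[|k]]]; rewrite !coefE /=
  ?(mulr0,mulr1,addr0,add0r) //.
by rewrite nth_default // (leq_trans sp).
Qed.

(** * Taylor expansion of cell averages *)

(** The remainder [r] has derivative [r' x = f' x - f' 0 - f'' 0 x = o(x)], and
    [r 0 = 0], so the mean value theorem between 0 and [x] gives
    [r x = o(x) x]. *)
Lemma taylor_young2 (R : realType) (f : R -> R) (e : R) : 0 < e ->
  (\forall x \near (0 : R), derivable f x 1) ->
  derivable (derive1 f) (0 : R) 1 ->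
  \forall x \near (0 : R),
  `|f x - (f 0 + derive1 f 0 * x + derive1 (derive1 f) 0 / 2 * x ^+ 2)|
    <= e * x ^+ 2.
Proof.
move=> e0 df ddf.
have ddf0 : \forall x \near (0 : R),
    `|derive1 f x - (derive1 f 0 + derive1 (derive1 f) 0 * x)| <= e * `|x|.
  have /eqaddoP/(_ e e0) := derivable_nbhs ddf.
  apply: filterS => x /=.
  by rewrite !fctE /= addr0 [x%:A]mulr1 -derive1E [_ *: _]mulrC.
have [d /= d0 near0] := (nbhs_ballP _ _).1 (filterI df ddf0).
apply/nbhs_ballP; exists d => //= x; rewrite -ball_normE /= sub0r normrN => xd.
pose r : R -> R := f - horner ((f 0)%:P + derive1 f 0 *: 'X
  + (derive1 (derive1 f) 0 / 2) *: 'X^2).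
have rE y : r y = f y - (f 0 + derive1 f 0 * y
    + derive1 (derive1 f) 0 / 2 * y ^+ 2).
  by rewrite /r !fctE /= !hornerE.
pose r' (y : R) : R := derive1 f y - (derive1 f 0 + derive1 (derive1 f) 0 * y).
have near_x (y : R) : `|y| <= `|x| -> derivable f y 1 /\ `|r' y| <= e * `|x|.
  move=> yx; have [|dfy r'y] := near0 y.
    by rewrite -ball_normE /= sub0r normrN (le_lt_trans yx).
  by split => //; rewrite (le_trans r'y) // ler_pM2l.
have is_derive_r (y : R) : `|y| <= `|x| -> is_derive y 1 r (r' y).
  move=> /near_x[dfy _]; apply: is_deriveB.
    by rewrite derive1E; exact/derivableP.
  by apply: is_derive_eq; rewrite !poly.derivE !hornerE /=; field.
have cont_r (a b : R) : (forall y, a <= y <= b -> `|y| <= `|x|) ->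
    {within `[a, b], continuous r}.
  move=> ab; apply: derivable_within_continuous => z zab.
  by have [] := is_derive_r z (ab _ zab).
have r0 : r 0 = 0 by rewrite rE; ring.
rewrite -rE.
have mvt (a b : R) : a <= b -> (forall y, a <= y <= b -> `|y| <= `|x|) ->
    exists2 c, `|c| <= `|x| & r b - r a = r' c * (b - a).
  move=> leab ab.
  have dr z : z \in `]a, b[ -> is_derive z (1 : R) r (r' z).
    by rewrite in_itv /= => /andP[/ltW az /ltW zb]; apply/is_derive_r/ab/andP.
  have [c + ->] := MVT_segment leab dr (cont_r _ _ ab).
  by rewrite in_itv /= => /ab cx; exists c.
have [c cx ->] : exists2 c, `|c| <= `|x| & r x = r' c * x.
  have [x0|/ltW x0] := leP 0 x.
    have [y /andP[y0 yx]|c cx] := mvt _ _ x0; first by rewrite !ger0_norm.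
    by rewrite r0 !subr0; exists c.
  have [y /andP[xy y0]|c cx] := mvt _ _ x0; first by rewrite !ler0_norm ?lerN2.
  by rewrite r0 !sub0r mulrN => /oppr_inj ->; exists c.
rewrite normrM -[x ^+ 2]real_normK ?num_real // expr2 mulrA.
by rewrite ler_wpM2r // (near_x c cx).2.
Qed.

(** The remainder of the Taylor polynomial is at most [e h^2] on the whole cell,
    hence so is its average; the average of the Taylor polynomial itself is
    known exactly, and only its quadratic term is left in the quotient. *)
Lemma cell_average_taylor (R : realType) (u : R -> R) (i : int) :
  (\forall x \near (0 : R), derivable u x 1) ->
  derivable (derive1 u) (0 : R) 1 ->
  (cell_average u h i - (u 0 + derive1 u 0 * (i%:~R * h))) / h ^+ 2
    @[h --> (0 : R)^'+] -->
  derive1 (derive1 u) 0 / 2 * (i%:~R ^+ 2 + 12^-1).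
Proof.
move=> du ddu; apply/cvgrPdist_le => e e0.
pose M : R := `|i%:~R| + 2^-1.
have M0 : 0 < M by rewrite ltr_wpDl.
have eM0 : 0 < e / M ^+ 2 by rewrite divr_gt0 // exprn_gt0.
(* [|x| <= M h] on the cell, so the bound [e / M^2 x^2] becomes [e h^2]. *)
have [d /= d0 near0] :=
  (nbhs_ballP _ _).1 (filterI du (taylor_young2 eM0 du ddu)).
near=> h.
have h0 : 0 < h by [].
have hd : M * h < d.
  rewrite mulrC -ltr_pdivlMr //.
  by near: h; apply: nbhs_right_lt; exact: divr_gt0.
pose T x := u 0 + derive1 u 0 * x + derive1 (derive1 u) 0 / 2 * x ^+ 2.
have cellM x : cell h i x -> `|x| <= M * h.
  rewrite /cell /= in_itv /= => /andP[lx xr]; rewrite ler_norml; apply/andP.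
  have := ler_norm (i%:~R : R); have := lerNnormlW (lexx `|i%:~R : R|).
  by rewrite /M => ? ?; split; nra.
have near_cell x : cell h i x -> derivable u x 1 /\ `|u x - T x| <= e * h ^+ 2.
  move=> /cellM xM; have [|dux uT] := near0 x.
    by rewrite -ball_normE /= sub0r normrN (le_lt_trans xM).
  split => //; apply: (le_trans uT).
  have -> : e * h ^+ 2 = e / M ^+ 2 * (M * h) ^+ 2 by field; lra.
  rewrite ler_wpM2l ?(ltW eM0) // -[x ^+ 2]real_normK ?num_real //.
  by rewrite lerXn2r ?nnegrE // mulr_ge0 // ltW.
have int_cell (f : R -> R) : {within cell h i, continuous f} ->
    lebesgue_measure.-integrable (cell h i) (EFin \o f).
  by apply: continuous_compact_integrable; exact: segment_compact.
have cont_u : {within cell h i, continuous u}.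
  by apply: derivable_within_continuous => x xi; exact: (near_cell _ xi).1.
have cont_T : {within cell h i, continuous T}.
  have -> : T = horner ((u 0)%:P + derive1 u 0 *: 'X
      + (derive1 (derive1 u) 0 / 2) *: 'X^2).
    by apply/funext => x; rewrite /T !hornerE.
  exact/continuous_subspaceT/continuous_horner.
have cont_uT : {within cell h i, continuous (u \- T)}.
  by move=> x; apply: continuousB; [exact: cont_u|exact: cont_T].
have cont_normuT : {within cell h i, continuous (fun x => `|u x - T x|)}.
  by move=> x; apply: (continuous_comp (cont_uT x)); exact: norm_continuous.
have mcell : measurable (cell h i) by exact: measurable_itv.
have intT := Rintegral_cell_quadratic i (u 0) (derive1 u 0)
  (derive1 (derive1 u) 0 / 2) h0.
have bound : `|\int[lebesgue_measure]_(x in cell h i) u x -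
    \int[lebesgue_measure]_(x in cell h i) T x| <= h * (e * h ^+ 2).
  rewrite -RintegralB //; [|exact: int_cell..].
  apply: le_trans (le_normr_Rintegral _ (int_cell _ cont_uT)) _ => //.
  have := Rintegral_cell_quadratic i (e * h ^+ 2) 0 0 h0.
  rewrite !mul0r !addr0 => <-.
  apply: le_Rintegral => //.
  - exact: int_cell.
  - apply: int_cell.
    under eq_fun do rewrite !mul0r !addr0.
    by apply: continuous_subspaceT => ?; exact: cvg_cst.
  - by move=> x /near_cell[_ xT]; rewrite !mul0r !addr0.
move: bound; rewrite /cell_average {}intT.
set U := Rintegral _ _ _; rewrite distrC => bound.
have -> : derive1 (derive1 u) 0 / 2 * (i%:~R ^+ 2 + 12^-1) -
    (U / h - (u 0 + derive1 u 0 * (i%:~R * h))) / h ^+ 2 =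
    (h * (u 0 + derive1 u 0 * (i%:~R * h) +
     derive1 (derive1 u) 0 / 2 * (i%:~R ^+ 2 + 12^-1) * h ^+ 2) - U) / h ^+ 3.
  by field; lra.
have h3 : 0 < h ^+ 3 by rewrite exprn_gt0.
rewrite normrM normfV (gtr0_norm h3) ler_pdivrMr //.
by apply: (le_trans bound); rewrite exprS; lra.
Unshelve. all: by end_near. Qed.

(** * Smoothness indicators of quadratics *)

Lemma cell_average_horner (R : realType) (h : R) (i : int) (p : {poly R}) :
  0 < h -> (size p <= 3)%N ->
  cell_average (fun x => p.[x]) h i =
  p`_0 + p`_1 * h * i%:~R + p`_2 * h ^+ 2 * (i%:~R ^+ 2 + 12^-1).
Proof.
move=> h0 sp.
have pE x : p.[x] = p`_0 + p`_1 * x + p`_2 * x ^+ 2.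
  by rewrite {1}(quadratic_coef sp) !hornerE.
rewrite /cell_average; under eq_Rintegral do rewrite pE.
by rewrite Rintegral_cell_quadratic //; field; lra.
Qed.

(** With [p' = p1 + 2 p2 x] and [p'' = 2 p2], the first derivative contributes
    [(p1 h)^2 + 1/3 (p2 h^2)^2] and the second [4 (p2 h^2)^2]. *)
Lemma smoothness_indicator_quadratic (R : realType) (h : R) (p : {poly R}) :
  0 < h -> (size p <= 3)%N ->
  smoothness_indicator h p =
  (p`_1 * h) ^+ 2 + 13 / 3 * (p`_2 * h ^+ 2) ^+ 2.
Proof.
move=> h0 sp; rewrite /smoothness_indicator.
pose I b := \int[lebesgue_measure]_(x in cell h 0) (p^`(b).[x] ^+ 2).
have I0 b : (size p <= b)%N -> I b = 0.
  move=> pb; rewrite /I derivn_poly0 //.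
  under eq_Rintegral do rewrite horner0 expr0n /=.
  by rewrite Rintegral_cst ?mul0r //; exact: measurable_itv.
(* The terms beyond the degree vanish, so the sum may always run up to 2. *)
rewrite (big_nat_widen _ _ 3) // big_mkcond /=.
rewrite (eq_bigr (fun b => h ^+ (2 * b - 1) * I b)); last first.
  by move=> b _; case: ltnP => // /I0 ->; rewrite mulr0.
have I1E : I 1%N = h * (p`_1 ^+ 2 + (p`_2 * h) ^+ 2 / 3).
  have dE x : p^`(1).[x] ^+ 2 =
      p`_1 ^+ 2 + 4 * p`_1 * p`_2 * x + 4 * p`_2 ^+ 2 * x ^+ 2.
    by rewrite {1}(quadratic_coef sp) derivn1 !poly.derivE !hornerE /=; ring.
  rewrite /I; under eq_Rintegral do rewrite dE.
  by rewrite Rintegral_cell_quadratic //; field.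
have I2E : I 2%N = h * (4 * p`_2 ^+ 2).
  have dE x : p^`(2).[x] ^+ 2 = 4 * p`_2 ^+ 2 + 0 * x + 0 * x ^+ 2.
    rewrite {1}(quadratic_coef sp) !derivnS derivn0 !poly.derivE !hornerE /=.
    by ring.
  rewrite /I; under eq_Rintegral do rewrite dE.
  by rewrite Rintegral_cell_quadratic //; field.
by rewrite big_ltn // big_nat1 I1E I2E; field.
Qed.

(** * Limits from the right at 0 *)

Lemma cancels_up_toP (R : realType) (g : R -> R) (n : nat) :
  cancels_up_to g n <-> g h / h ^+ n @[h --> (0 : R)^'+] --> (0 : R).
Proof.
have dist (e h : R) : 0 < h ->
    (`|g h| <= e * `|h ^+ n|) = (`|g h / h ^+ n| <= e).
  by move=> h0; rewrite normrM normfV ler_pdivrMr // normr_gt0 expf_neq0 ?gt_eqF.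
rewrite /cancels_up_to; split.
  move=> /eqoP go; apply/cvgr0Pnorm_le => e e0; have := go e e0.
  by apply: filterS2 (nbhs_right_gt 0) => h h0; rewrite dist.
move=> /cvgr0Pnorm_le go; apply/eqoP => e e0; have := go e e0.
by apply: filterS2 (nbhs_right_gt 0) => h h0; rewrite dist.
Qed.

Lemma cvg_id_at_right0 (R : realType) : (h : R) @[h --> (0 : R)^'+] --> (0 : R).
Proof. exact/cvg_at_right_filter/cvg_id. Qed.

(** Transports a limit assembled from algebraic operations to the intended
    function and value; positivity of [h] is what allows to clear the
    denominators when comparing the two functions. *)
Lemma near_eq_cvg_to (R : realType) (f g : R -> R) (l l' : R) :
  f h @[h --> (0 : R)^'+] --> l -> l = l' ->
  (\forall h \near (0 : R)^'+, 0 < h -> f h = g h) ->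
  g h @[h --> (0 : R)^'+] --> l'.
Proof.
move=> fl <- fg; apply: cvg_trans fl; apply: near_eq_cvg.
by apply: filterS2 (nbhs_right_gt 0) fg => h h0; apply.
Qed.

(** * Differences of cell averages *)

Definition central_diff (R : realType) (u : R -> R) (h : R) : R :=
  (cell_average u h 1 - cell_average u h (-1)) / 2.

Definition second_diff (R : realType) (u : R -> R) (h : R) : R :=
  cell_average u h 1 - 2 * cell_average u h 0 + cell_average u h (-1).

(** In [c - 2 b + a] the terms of order 0 and 1 cancel, and the quadratic
    terms, in units of [u''(0)/2 h^2], add up to
    [(1 + 1/12) - 2/12 + (1 + 1/12) = 2]. *)
Lemma second_diff_cvg (R : realType) (u : R -> R) :
  (\forall x \near (0 : R), derivable u x 1) ->
  derivable (derive1 u) (0 : R) 1 ->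
  second_diff u h / h ^+ 2 @[h --> (0 : R)^'+] --> derive1 (derive1 u) 0.
Proof.
move=> du ddu.
have avg i := cell_average_taylor (i := i) du ddu.
apply: (near_eq_cvg_to
  (cvgD (cvgB (avg 1) (cvgM (cvg_cst (2 : R)) (avg 0))) (avg (-1)))) => /=.
  by field.
by apply: nearW => h h0; rewrite /second_diff ?fctE /=; field; lra.
Qed.

(** In [c - a] the terms of order 0 cancel, the linear ones add up to
    [2 u'(0) h], and the rest is of order [h^2]. *)
Lemma central_diff_cvg (R : realType) (u : R -> R) :
  (\forall x \near (0 : R), derivable u x 1) ->
  derivable (derive1 u) (0 : R) 1 ->
  central_diff u h / h @[h --> (0 : R)^'+] --> derive1 u 0.
Proof.
move=> du ddu.
have avg i := cell_average_taylor (i := i) du ddu.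
apply: (near_eq_cvg_to (cvgD (cvg_cst (derive1 u 0)) (cvgM (@cvg_id_at_right0 R)
  (cvgM (cvg_cst (2^-1 : R)) (cvgB (avg 1) (avg (-1))))))) => /=.
  by rewrite mul0r addr0.
by apply: nearW => h h0; rewrite /central_diff ?fctE /=; field; lra.
Qed.

(** * Smoothness indicators of the three reconstructions *)

(** The slope of the polynomial times [h] is the one-sided difference [b - a],
    that is [D - E/2]. *)
Lemma smoothness_indicator_left (R : realType) (u : R -> R) (h : R) p :
  0 < h -> reconstructs u h 1 [:: -1; 0] p ->
  smoothness_indicator h p = (central_diff u h - second_diff u h / 2) ^+ 2.
Proof.
move=> h0 [sp pu]; have sp3 := leqW sp.
have := pu (-1); have := pu 0; rewrite !inE /= => /(_ isT) u0 /(_ isT) ul.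
rewrite smoothness_indicator_quadratic // /central_diff /second_diff -u0 -ul.
by rewrite !cell_average_horner // (nth_default 0 sp); field.
Qed.

(** Here the slope times [h] is [c - b = D + E/2]. *)
Lemma smoothness_indicator_right (R : realType) (u : R -> R) (h : R) p :
  0 < h -> reconstructs u h 1 [:: 0; 1] p ->
  smoothness_indicator h p = (central_diff u h + second_diff u h / 2) ^+ 2.
Proof.
move=> h0 [sp pu]; have sp3 := leqW sp.
have := pu 1; have := pu 0; rewrite !inE /= => /(_ isT) u0 /(_ isT) ur.
rewrite smoothness_indicator_quadratic // /central_diff /second_diff -u0 -ur.
by rewrite !cell_average_horner // (nth_default 0 sp); field.
Qed.

(** The coefficients satisfy [p1 h = D] and [p2 h^2 = E/2], whence the factor
    [13/12 = 13/3 / 4]. *)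
Lemma smoothness_indicator_opt (R : realType) (u : R -> R) (h : R) p :
  0 < h -> reconstructs u h 2 [:: -1; 0; 1] p ->
  smoothness_indicator h p =
  central_diff u h ^+ 2 + 13 / 12 * second_diff u h ^+ 2.
Proof.
move=> h0 [sp pu].
have := pu 1; have := pu 0; have := pu (-1); rewrite !inE /=.
move=> /(_ isT) ul /(_ isT) u0 /(_ isT) ur.
rewrite smoothness_indicator_quadratic // /central_diff /second_diff -u0 -ul -ur.
by rewrite !cell_average_horner //; field.
Qed.

(** * The global smoothness indicator *)

Theorem mainTheorem7 (R : realType) (u : R -> R) (hu : smooth_near0 u)
    (P1 P2 Popt : R -> {poly R})
    (hP1 : \forall h \near (0 : R)^'+,
       reconstructs u h 1 [:: -1; 0] (P1 h))
    (hP2 : \forall h \near (0 : R)^'+,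
       reconstructs u h 1 [:: 0; 1] (P2 h))
    (hPopt : \forall h \near (0 : R)^'+,
       reconstructs u h 2 [:: -1; 0; 1] (Popt h)) :
  let I0 := fun h : R => smoothness_indicator h (Popt h) in
  let I1 := fun h : R => smoothness_indicator h (P1 h) in
  let I2 := fun h : R => smoothness_indicator h (P2 h) in
  let combination := fun (l0 l1 l2 h : R) =>
    l0 * I0 h + l1 * I1 h + l2 * I2 h in
  let tau3 := fun t h : R => `| t * I1 h + t * I2 h - 2 * t * I0 h | in
  [/\ forall l0 l1 l2 : R, l1 = l2 -> l0 = - 2 * l1 ->
        cancels_up_to (combination l0 l1 l2) 3,
      derive1n 2 u 0 != 0 ->
        forall l0 l1 l2 : R, l1 = l2 -> l0 = - 2 * l1 -> l1 != 0 ->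
        ~ cancels_up_to (combination l0 l1 l2) 4,
      derive1 u 0 != 0 -> derive1n 2 u 0 != 0 ->
        forall l0 l1 l2 : R, l0 + l1 + l2 = 0 ->
        ~ (l0 = 0 /\ l1 = 0 /\ l2 = 0) ->
        ~ cancels_up_to (combination l0 l1 l2) 4
    & derive1n 2 u 0 != 0 -> forall t : R, t != 0 -> theta_eq (tau3 t) 4 ].
Proof.
move=> I0 I1 I2 combination tau3.
pose D := central_diff u; pose E := second_diff u.
have combE : \forall h \near (0 : R)^'+, forall l0 l1 l2 : R,
    l0 + l1 + l2 = 0 -> combination l0 l1 l2 h =
    (l2 - l1) * (D h * E h) + 5 / 6 * l0 * E h ^+ 2.
  near=> h => l0 l1 l2 l_sum.
  have h0 : 0 < h by [].
  rewrite /combination /I0 /I1 /I2.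
  rewrite (smoothness_indicator_opt h0 (near hPopt h _)) //.
  rewrite (smoothness_indicator_left h0 (near hP1 h _)) //.
  rewrite (smoothness_indicator_right h0 (near hP2 h _)) //.
  by rewrite -/D -/E (_ : l1 = - l0 - l2); [field|lra].
have [du ddu] : (\forall x \near (0 : R), derivable u x 1) /\
    derivable (derive1 u) (0 : R) 1.
  split; first by apply: filterS hu => x /(_ 0%N).
  exact: nbhs_singleton hu 1%N.
have cvgE : E h / h ^+ 2 @[h --> (0 : R)^'+] --> derive1n 2 u 0.
  exact: second_diff_cvg.
have cvgD1 : D h / h @[h --> (0 : R)^'+] --> derive1 u 0.
  exact: central_diff_cvg.
have cvg3 l0 l1 l2 : l0 + l1 + l2 = 0 ->
    combination l0 l1 l2 h / h ^+ 3 @[h --> (0 : R)^'+] -->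
    (l2 - l1) * (derive1 u 0 * derive1n 2 u 0).
  move=> l_sum.
  apply: (near_eq_cvg_to (cvgD (cvgM (cvg_cst (l2 - l1)) (cvgM cvgD1 cvgE))
    (cvgM (@cvg_id_at_right0 R)
      (cvgM (cvg_cst (5 / 6 * l0)) (cvgM cvgE cvgE))))) => /=.
    by rewrite mul0r addr0.
  by near=> h => h0; rewrite (near combE h _) // ?fctE /=; field; lra.
have cvg4 (l0 l1 l2 : R) : l1 = l2 -> l0 = - 2 * l1 ->
    combination l0 l1 l2 h / h ^+ 4 @[h --> (0 : R)^'+] -->
    5 / 6 * l0 * (derive1n 2 u 0 * derive1n 2 u 0).
  (* The coefficient of [D E] vanishes identically. *)
  move=> <- ->.
  apply: (near_eq_cvg_to (cvgM (cvg_cst (5 / 6 * (- 2 * l1)))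
    (cvgM cvgE cvgE))) => //=.
  near=> h => h0.
  rewrite (near combE h _) //; last by ring.
  by rewrite ?fctE /=; field; lra.
have not4 (l0 l1 l2 : R) : derive1n 2 u 0 != 0 -> l1 = l2 -> l0 = - 2 * l1 ->
    l1 != 0 -> ~ cancels_up_to (combination l0 l1 l2) 4.
  move=> u2 l12 l01 l1n0 /cancels_up_toP c4.
  have /eqP : 0 = 5 / 6 * l0 * (derive1n 2 u 0 * derive1n 2 u 0).
    exact: norm_cvg_unique c4 (cvg4 _ _ _ l12 l01).
  rewrite l01 eq_sym !mulf_eq0 (negPf u2) (negPf l1n0) /=.
  by apply/negP; lra.
split.
- move=> l0 l1 l2 l12 l01; apply/cancels_up_toP.
  have := cvg3 l0 l1 l2; rewrite l12 subrr mul0r; apply.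
  by rewrite l01 l12; ring.
- by move=> u2 l0 l1 l2; exact: not4.
- move=> u1 u2 l0 l1 l2 l_sum l_n0 c4.
  (* Vanishing to order 4 includes order 3, whose coefficient is known. *)
  have c3 : combination l0 l1 l2 h / h ^+ 3 @[h --> (0 : R)^'+] --> (0 : R).
    have /cancels_up_toP c4' := c4.
    apply: (near_eq_cvg_to (cvgM (@cvg_id_at_right0 R) c4')) => /=.
      by rewrite mul0r.
    by apply: nearW => h h0; rewrite ?fctE /=; field; lra.
  have /eqP : 0 = (l2 - l1) * (derive1 u 0 * derive1n 2 u 0).
    exact: norm_cvg_unique c3 (cvg3 _ _ _ l_sum).
  rewrite eq_sym !mulf_eq0 (negPf u1) (negPf u2) !orbF subr_eq0 => /eqP l21.
  have l01 : l0 = - 2 * l1 by move: l_sum; rewrite l21; lra.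
  apply: (not4 _ _ _ u2 (esym l21) l01 _ c4); apply/eqP => l1_0.
  by apply: l_n0; rewrite l01 l21 l1_0; split; [ring|].
- move=> u2 t t0; move: (derive1n 2 u 0) cvg4 u2 => w cvg4w w0.
  exists (5 / 3 * `|t| * w ^+ 2).
    by rewrite !mulf_neq0 ?normr_eq0 ?expf_neq0 ?invr_eq0 //; lra.
  apply/cancels_up_toP.
  apply: (near_eq_cvg_to (cvgB (cvg_norm (cvg4w _ _ _ (erefl t) erefl))
    (cvg_cst (5 / 3 * `|t| * w ^+ 2)))) => /=.
    have -> : 5 / 6 * (- 2 * t) * (w * w) = - (5 / 3 * w ^+ 2) * t by field.
    have w2 : 0 <= 5 / 3 * w ^+ 2 by rewrite mulr_ge0 ?sqr_ge0 //; lra.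
    by rewrite normrM normrN (ger0_norm w2); ring.
  apply: nearW => h h0; rewrite ?fctE /=.
  have -> : combination (- 2 * t) t t h = t * I1 h + t * I2 h - 2 * t * I0 h.
    by rewrite /combination; ring.
  by rewrite normrM normfV (gtr0_norm (exprn_gt0 4 h0)) /tau3; field; lra.
Unshelve. all: by end_near. Qed.
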